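(* Let $R$ be an arbitrary (associative and commutative) radically Noetherian domain containing the field of rational numbers $\mathbb{Q}=\mathbb{Q}\cdot 1\subseteq R$, and let $m\ge1$. Then (a) every free algebra over $R$ of the variety $\mathrm{Var}(L_m)$ is equationally Noetherian; (b) every free algebra over $R$ of the variety $\mathrm{Var}(W_m)$ is equationally Noetherian.
   Context: $R$ has identity; it is radically Noetherian if it satisfies the ascending chain condition on radical (radically closed) ideals. $L_m$ and $W_m$: let $C_m=R[x_1,\ldots,x_m]$ with $\delta_i=\partial/\partial x_i$, and let $B$ be the free left $C_m$-module of formal sums $f_1\delta_1+\cdots+f_m\delta_m$, $f_i\in C_m$. $L_m$ (the left-symmetric Witt algebra) is the $R$-algebra $\langle B,\circ\rangle$ with $R$-bilinear product determined by $f\delta_i\circ g\delta_j=f\,\delta_i(g)\,\delta_j$ ($f,g\in C_m$); $W_m$ (the Witt algebra) is the Lie $R$-algebra $\langle B,[\cdot,\cdot]\rangle$ with $[u,v]=u\circ v-v\circ u$. $\mathrm{Var}(X)$ denotes the variety of $R$-algebras generated by $X$. Equationally Noetherian: let $A$ be an $R$-algebra and $\mathfrak{M}$ a variety of $R$-algebras with $A\in\mathfrak{M}$. For $k\ge 1$ let $\mathfrak{M}\langle z_1,\ldots,z_k\rangle$ be the free algebra of $\mathfrak{M}$ on $z_1,\ldots,z_k$, and let $D=A\sqcup_{\mathfrak{M}}\mathfrak{M}\langle z_1,\ldots,z_k\rangle$ be the coproduct in $\mathfrak{M}$ (only varieties for which both canonical maps into $D$ are injective are considered). For $f\in D$ and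 $(a_1,\ldots,a_k)\in A^k$ put $f(a_1,\ldots,a_k)=\phi(f)$, where $\phi:D\to A$ is the unique homomorphism that is the identity on $A$ and sends $z_i$ to $a_i$. For $S\subseteq D$ put $Z(S)=\{a\in A^k : f(a)=0 \text{ for all } f\in S\}$. The sets $Z(S)$ define (as a subbasis of closed sets) the Zariski topology on $A^k$. $A$ is equationally Noetherian if $A^k$ is a Noetherian topological space for every $k\ge1$; equivalently, for every $k$ and every $S\subseteq D$ there is a finite $S_0\subseteq S$ with $Z(S)=Z(S_0)$. This does not depend on the choice of $\mathfrak{M}$ containing $A$ (one may take the variety generated by $A$). *)

(* Defs.v *)
From HB Require Import structures.
From mathcomp Require Import all_boot all_order all_algebra.
From mathcomp Require Import mpoly.

Set Implicit Arguments.
Unset Strict Implicit.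
Unset Printing Implicit Defensive.

Import GRing.Theory.
Local Open Scope ring_scope.

(* Subsets are [Prop]-valued predicates throughout, so that nothing is        *)
(* restricted to decidable subsets.                                           *)

Section RadicalIdeals.
Variable R : comNzRingType.

Definition is_ideal (I : R -> Prop) : Prop :=
  [/\ I 0, forall a b, I a -> I b -> I (a + b) & forall r a, I a -> I (r * a)].

Definition is_radical_ideal (I : R -> Prop) : Prop :=
  is_ideal I /\ forall (r : R) (n : nat), I (r ^+ n) -> I r.

Definition radically_noetherian : Prop :=
  forall I : nat -> R -> Prop,
    (forall n, is_radical_ideal (I n)) ->
    (forall n r, I n r -> I n.+1 r) ->
    exists N, forall n, (N <= n)%N -> forall r, I n r <-> I N r.

End RadicalIdeals.

Section Algebras.
Variable R : comNzRingType.

(* R-algebras: no associativity, commutativity or unit is required.           *)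
Record nalg := NAlg {
  nalg_sort :> lmodType R;
  nalg_mul : nalg_sort -> nalg_sort -> nalg_sort;
  nalg_bilinear : bilinear_for *:%R *:%R nalg_mul
}.

Definition is_nalg_hom (A B : nalg) (f : A -> B) : Prop :=
  linear f /\ forall x y, f (nalg_mul x y) = nalg_mul (f x) (f y).

(* Nonassociative polynomials with coefficients in R; the identity given by t *)
(* is t = 0.                                                                  *)
Inductive napoly :=
  | PVar of nat
  | PAdd of napoly & napoly
  | PScale of R & napoly
  | PMul of napoly & napoly.

Fixpoint napoly_eval (A : nalg) (v : nat -> A) (t : napoly) : A :=
  match t with
  | PVar n => v n
  | PAdd t1 t2 => napoly_eval v t1 + napoly_eval v t2
  | PScale r t1 => r *: napoly_eval v t1
  | PMul t1 t2 => nalg_mul (napoly_eval v t1) (napoly_eval v t2)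
  end.

Definition satisfies (A : nalg) (t : napoly) : Prop :=
  forall v : nat -> A, napoly_eval v t = 0.

(* A variety is presented by a set of identities.                             *)
Definition variety := napoly -> Prop.

Definition in_variety (M : variety) (A : nalg) : Prop :=
  forall t, M t -> satisfies A t.

(* Var(A) is defined by all the identities of A.                              *)
Definition Var (A : nalg) : variety := satisfies A.

Lemma Var_smallest (A B : nalg) :
  in_variety (Var A) B <-> forall M, in_variety M A -> in_variety M B.
Proof.
split=> [AB M MA t /MA At | AB]; first exact: AB.
by apply: AB => t.
Qed.

Definition is_free (M : variety) (X : Type) (F : nalg) (i : X -> F) : Prop :=
  in_variety M F /\
  forall (B : nalg) (g : X -> B), in_variety M B ->
    exists h : F -> B, [/\ is_nalg_hom h, forall x, h (i x) = g x &
      forall h' : F -> B, is_nalg_hom h' -> (forall x, h' (i x) = g x) ->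
        h' =1 h].

Definition is_coproduct (M : variety) (A F D : nalg)
    (iA : A -> D) (iF : F -> D) : Prop :=
  [/\ in_variety M D, is_nalg_hom iA, is_nalg_hom iF &
  forall (B : nalg) (g : A -> B) (h : F -> B), in_variety M B ->
    is_nalg_hom g -> is_nalg_hom h ->
    exists u : D -> B,
      [/\ is_nalg_hom u, forall a, u (iA a) = g a, forall f, u (iF f) = h f &
        forall u' : D -> B, is_nalg_hom u' ->
          (forall a, u' (iA a) = g a) -> (forall f, u' (iF f) = h f) ->
          u' =1 u]].

End Algebras.

Arguments PVar {R} _.
Arguments Var {R} A _.

(* The closed sets of the topology on T with subbasis of closed sets B.       *)
Inductive closed_from (T : Type) (B : (T -> Prop) -> Prop) :
    (T -> Prop) -> Prop :=
  | closed_sub C of B C : closed_from B C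
  | closed_empty : closed_from B (fun=> False)
  | closed_union C D of closed_from B C & closed_from B D :
      closed_from B (fun x => C x \/ D x)
  | closed_inter (E : (T -> Prop) -> Prop) of
      (forall C, E C -> closed_from B C) :
      closed_from B (fun x => forall C, E C -> C x)
  | closed_ext C D of closed_from B C & (forall x, C x <-> D x) :
      closed_from B D.

Definition noetherian_topology (T : Type)
    (closed_set : (T -> Prop) -> Prop) : Prop :=
  forall C : nat -> T -> Prop,
    (forall n, closed_set (C n)) ->
    (forall n x, C n.+1 x -> C n x) ->
    exists N, forall n, (N <= n)%N -> forall x, C n x <-> C N x.

Section EquationallyNoetherian.
Variables (R : comNzRingType) (A F D : nalg R) (k : nat).
Variables (z : 'I_k -> F) (iA : A -> D) (iF : F -> D).

(* f(a) = b; the homomorphism phi is unique when D is the coproduct of A and  *)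
(* the free algebra F on z.                                                   *)
Definition evaluates_to (f : D) (a : {ffun 'I_k -> A}) (b : A) : Prop :=
  exists phi : D -> A,
    [/\ is_nalg_hom phi, forall c, phi (iA c) = c,
        forall j, phi (iF (z j)) = a j & phi f = b].

Definition zero_set (S : D -> Prop) : {ffun 'I_k -> A} -> Prop :=
  fun a => forall f, S f -> evaluates_to f a 0.

Definition zariski_closed : ({ffun 'I_k -> A} -> Prop) -> Prop :=
  closed_from (fun C => exists S : D -> Prop, C = zero_set S).

End EquationallyNoetherian.

(* F is M<z_1, ..., z_k> and D its coproduct with A in M, both determined up  *)
(* to isomorphism.  Injectivity of iA and iF is automatic: pairing an         *)
(* identity with a zero homomorphism gives retractions D -> A and D -> F.     *)
Definition equationally_noetherian (R : comNzRingType) (A : nalg R) : Prop :=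
  forall M : variety R, in_variety M A ->
  forall k : nat, (0 < k)%N ->
  forall (F : nalg R) (z : 'I_k -> F), is_free M z ->
  forall (D : nalg R) (iA : A -> D) (iF : F -> D), is_coproduct M iA iF ->
  injective iA -> injective iF ->
  noetherian_topology (zariski_closed z iA iF).

Section Witt.
Variables (R : comNzRingType) (m : nat).

(* u : witt_vf stands for u_1 d_1 + ... + u_m d_m, where d_i = d/dx_i.        *)
Local Notation witt_vf := {ffun 'I_m -> {mpoly R[m]}}.

Definition lsw_mul (u v : witt_vf) : witt_vf :=
  [ffun j => \sum_(i < m) u i * (v j)^`M(i)].

Definition single_vf (f : {mpoly R[m]}) (i : 'I_m) : witt_vf :=
  [ffun j => if j == i then f else 0].

Lemma lsw_mul_single (f g : {mpoly R[m]}) (i j : 'I_m) :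
  lsw_mul (single_vf f i) (single_vf g j) = single_vf (f * g^`M(i)) j.
Proof.
apply/ffunP => l; rewrite !ffunE (bigD1 i) //= !ffunE eqxx.
rewrite big1 ?addr0 => [|h /negPf hi]; last by rewrite !ffunE hi mul0r.
by case: eqP => // _; rewrite mderiv0 mulr0.
Qed.

Lemma lsw_mul_bilinear : bilinear_for *:%R *:%R lsw_mul.
Proof.
split=> [v a u w|u a v w]; apply/ffunP => j;
  rewrite /= /lsw_mul !ffunE.
  rewrite scaler_sumr -big_split; apply: eq_bigr => i _ /=.
  by rewrite !ffunE mulrDl scalerAl.
rewrite scaler_sumr -big_split; apply: eq_bigr => i _ /=.
by rewrite mderivD mderivZ mulrDr scalerAr.
Qed.

Definition witt_bracket (u v : witt_vf) : witt_vf := lsw_mul u v - lsw_mul v u.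

Lemma witt_bracket_bilinear : bilinear_for *:%R *:%R witt_bracket.
Proof.
case: lsw_mul_bilinear => Hl Hr.
split=> [v a u w|u a v w]; rewrite /= /witt_bracket.
  have -> : lsw_mul (a *: u + w) v = a *: lsw_mul u v + lsw_mul w v := Hl v a u w.
  by rewrite Hr scalerBr addrACA opprD.
have -> : lsw_mul (a *: v + w) u = a *: lsw_mul v u + lsw_mul w u := Hl u a v w.
by rewrite Hr scalerBr addrACA opprD.
Qed.

Definition left_symmetric_witt : nalg R := NAlg lsw_mul_bilinear.
Definition witt_algebra : nalg R := NAlg witt_bracket_bilinear.

End Witt.

(* Main.v *)
(* A free algebra A on X is separated by the homomorphisms to the algebra L of *)
(* polynomial vector fields that extend the maps v : X -> L, so the            *)
(* coordinates of the image of a, as functions of v, embed A into the vector   *)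
(* fields over a differential ring of functions; this ring is a domain because *)
(* its elements are polynomial along the lines s |-> v + s w.  The zero sets   *)
(* in A^k become zero sets of differential polynomials, and these satisfy the  *)
(* descending chain condition by the Ritt-Raudenbush basis theorem.            *)
(*                                                                             *)
(* Ritt-Raudenbush is proved on point sets, without differential ideals: call  *)
(* a set V of points bad if its induced topology is not Noetherian, and record *)
(* the pairs (u, d) such that some polynomial of degree d in its leader u      *)
(* vanishes on V while its leading coefficient and separant vanish nowhere on  *)
(* V.  By Dickson's lemma some bad V has a maximal set of such pairs, up to    *)
(* derivatives and larger d.  By induction on the leader and the degree, each  *)
(* f not identically 0 on V then cuts out a subset that is not bad: reduce f   *)
(* by the recorded polynomials and split off the zeros of its leading          *)
(* coefficient and of its separant; on the rest f records a new pair.  So V    *)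
(* itself is not bad.                                                          *)

From HB Require Import structures.
Require Import Defs.
From mathcomp Require Import all_boot all_order all_algebra.
From mathcomp Require Import mpoly boolp functions ring.
From Stdlib Require List.

Set Implicit Arguments.
Unset Strict Implicit.
Unset Printing Implicit Defensive.

Import Order.TTheory GRing.Theory.
Local Open Scope ring_scope.

(** * The Ritt-Raudenbush theorem for point sets *)

(** Evaluation at all maps [v : X -> L] turns an element of the free algebra into [m] functions of
    [v] ([coord]), and loses nothing, since an element killed by every homomorphism to [L] is zero
    ([free_Var_separated], [coord_inj]). Multiplication becomes a differential polynomial in these
    coordinates ([coord_mul]), so equations over the free algebra become differential polynomial
    equations with coefficients in the ring [line_poly_fun], a torsion-free domain with derivations
    ([line_poly_fun_domain]). Over such a ring every system has the zeros of a finite subsystem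
    ([ritt_raudenbush]). The core is [max_cover], which picks a counterexample [V] with a maximal
    set of leading pairs, and [null_or_noeth], by which a differential polynomial that is not null
    on [V] cuts out a set that is no counterexample. [dpoly_closed_noetherian] passes to chains of
    closed sets, and [free_equationally_noetherian] treats both products at once. *)

Section RittRaudenbush.
Variables (C : comPzRingType) (T I J : Type).
Hypothesis C_domain : forall a b : C, a * b = 0 -> a = 0 \/ b = 0.
Hypothesis C_torsion_free : forall (k : nat) (a : C), a *+ k.+1 = 0 -> a = 0.
Variable delta : I -> C -> C.
Hypothesis deltaD : forall i a b, delta i (a + b) = delta i a + delta i b.
Hypothesis deltaM : forall i a b, delta i (a * b) = delta i a * b + a * delta i b.
Variables (shift : I -> J -> J) (u : J -> T -> C).
Hypothesis u_shift : forall i x t, u (shift i x) t = delta i (u x t).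
Variable lt : J -> J -> Prop.
Hypothesis lt_wf : well_founded lt.
Hypothesis lt_trans : forall x y z, lt x y -> lt y z -> lt x z.
Hypothesis lt_total : forall x y, [\/ lt x y, x = y | lt y x].
Hypothesis lt_shift : forall i x, lt x (shift i x).
Hypothesis shift_mono : forall i x y, lt x y -> lt (shift i x) (shift i y).
Hypothesis dickson : forall s : nat -> J * nat, exists i j w,
  [/\ (i < j)%N, (s j).1 = foldr shift (s i).1 w & ((s i).2 <= (s j).2)%N].

Local Notation F := (T -> C).
Implicit Types (V : T -> Prop) (f g h : F) (x y z : J).

(** The bound comes first, so that [le x] is the predicate of the variables up to [x]. *)
Definition le x y := y = x \/ lt y x.

Lemma le_lt_shift i x y : le y x -> lt x (shift i y).
Proof.
by case=> [->|xy]; [exact: lt_shift|exact: lt_trans xy (lt_shift i y)].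
Qed.

Lemma foldr_shift_le x w : le (foldr shift x w) x.
Proof. by elim: w => [|i w IH]; [left|right; exact: le_lt_shift]. Qed.

Lemma delta0 i : delta i 0 = 0.
Proof. by apply: (addrI (delta i 0)); rewrite -deltaD !addr0. Qed.

Lemma delta1 i : delta i 1 = 0.
Proof.
by apply: (addrI (delta i 1)); rewrite addr0 -{3}[1]mulr1 deltaM mulr1 mul1r.
Qed.

(** For [n = 0] the truncated exponent [n.-1] is harmless, since [*+ n] kills the term; [upoly]
    relies on the same convention. *)
Lemma deltaX i a n : delta i (a ^+ n) = a ^+ n.-1 * delta i a *+ n.
Proof.
elim: n => [|n IH]; first by rewrite expr0 delta1 mulr0n.
rewrite exprS deltaM IH /= mulrS mulrC; congr (_ + _).
by case: n {IH} => [|n]; rewrite ?mulr0n ?mulr0 //= mulrnAr exprS mulrA.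
Qed.

(** * Differential polynomial functions and their leaders *)

Inductive dpoly (P : J -> Prop) : F -> Prop :=
  | DConst c : dpoly P (fun=> c)
  | DVar x of P x : dpoly P (u x)
  | DAdd f g of dpoly P f & dpoly P g : dpoly P (fun t => f t + g t)
  | DMul f g of dpoly P f & dpoly P g : dpoly P (fun t => f t * g t).

Lemma dpolyS (P Q : J -> Prop) f :
  (forall x, P x -> Q x) -> dpoly P f -> dpoly Q f.
Proof.
by move=> PQ; elim=> *; [exact: DConst|exact/DVar/PQ|exact: DAdd|exact: DMul].
Qed.

Lemma dpolyMn P f n : dpoly P f -> dpoly P (fun t => f t *+ n).
Proof.
move=> Pf; suff -> : (fun t => f t *+ n) = (fun t => f t * n%:R).
  by apply: DMul => //; exact: DConst.
by apply/funext => t; rewrite mulr_natr.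
Qed.

Lemma dpolyN P f : dpoly P f -> dpoly P (fun t => - f t).
Proof.
move=> Pf; suff -> : (fun t => - f t) = (fun t => f t * - 1).
  by apply: DMul => //; exact: DConst.
by apply/funext => t; rewrite mulrN1.
Qed.

Lemma dpolyX P f n : dpoly P f -> dpoly P (fun t => f t ^+ n).
Proof.
move=> Pf; elim: n => [|n IH]; first exact: DConst.
suff -> : (fun t => f t ^+ n.+1) = (fun t => f t * f t ^+ n) by exact: DMul.
by apply/funext => t; rewrite exprS.
Qed.

Lemma dpoly_delta (P Q : J -> Prop) i f :
    (forall x, P x -> Q x /\ Q (shift i x)) ->
  dpoly P f -> dpoly Q (fun t => delta i (f t)).
Proof.
move=> PQ; have PQ1 x : P x -> Q x by case/PQ.
elim=> [c|x Px|g h Pg IHg Ph IHh|g h Pg IHg Ph IHh].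
- exact: DConst.
- suff -> : (fun t => delta i (u x t)) = u (shift i x) by apply: DVar; case: (PQ x).
  by apply/funext => t; rewrite u_shift.
- suff -> : (fun t => delta i (g t + h t)) = fun t => delta i (g t) + delta i (h t).
    exact: DAdd.
  by apply/funext => t.
- suff -> : (fun t => delta i (g t * h t)) =
    fun t => delta i (g t) * h t + g t * delta i (h t).
    by apply: DAdd; apply: DMul => //; exact: dpolyS PQ1 _.
  by apply/funext => t.
Qed.

(** Finitely many variables occur in [f] and [lt] is total, so the largest of them bounds the
    others; with no variable at all, [f] is constant. *)
Lemma dpoly_le P f : dpoly P f ->
  (exists c, f = fun=> c) \/ exists x, P x /\ dpoly (le x) f.
Proof.
have comb Q : (forall P' g h, dpoly P' g -> dpoly P' h -> dpoly P' (Q g h)) ->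
    (forall a b : C, exists c, Q (fun=> a) (fun=> b) = fun=> c) ->
    forall g h,
    (exists c, g = fun=> c) \/ (exists x, P x /\ dpoly (le x) g) ->
    (exists c, h = fun=> c) \/ (exists x, P x /\ dpoly (le x) h) ->
    (exists c, Q g h = fun=> c) \/ exists x, P x /\ dpoly (le x) (Q g h).
  move=> QP Qc g h [[a ->]|[x [Px gx]]] [[b ->]|[y [Py hy]]].
  - by left; apply: Qc.
  - by right; exists y; split=> //; apply: QP => //; exact: DConst.
  - by right; exists x; split=> //; apply: QP => //; exact: DConst.
  - have le_lt a b z : lt a b -> le a z -> le b z.
      by move=> ab [->|za]; right=> //; exact: lt_trans ab.
    case: (lt_total x y) => [xy|xy|yx]; right.
    + by exists y; split=> //; apply: QP => //; apply: dpolyS gx => z; exact: le_lt.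
    + by exists y; split=> //; apply: QP => //; rewrite -xy.
    + by exists x; split=> //; apply: QP => //; apply: dpolyS hy => z; exact: le_lt.
elim=> [c|x Px|g h _ + _|g h _ + _].
- by left; exists c.
- by right; exists x; split=> //; apply: DVar; left.
- by apply: (comb (fun g h t => g t + h t)) => [*|a b]; [exact: DAdd|exists (a + b)].
- by apply: (comb (fun g h t => g t * h t)) => [*|a b]; [exact: DMul|exists (a * b)].
Qed.

(* [upoly x n f f']: f has degree less than n in u x, with coefficients in the *)
(* smaller variables, and f' is the formal derivative of f in u x.             *)
Inductive upoly x : nat -> F -> F -> Prop :=
  | UNil : upoly x 0 (fun=> 0) (fun=> 0)
  | UCons n f f' c of upoly x n f f' & dpoly (lt^~ x) c :
      upoly x n.+1 (fun t => f t + c t * u x t ^+ n)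
        (fun t => f' t + c t * u x t ^+ n.-1 *+ n).

Lemma upoly_dpoly x n f f' :
  upoly x n f f' -> dpoly (le x) f /\ dpoly (le x) f'.
Proof.
have lt_le y : lt y x -> le x y by right.
have xx : dpoly (le x) (u x) by apply: DVar; left.
elim=> [|k g g' c _ [Pg Pg'] Pc]; first by split; exact: DConst.
by split; apply: DAdd => //; last apply: dpolyMn;
  (apply: DMul; first exact: dpolyS lt_le _); exact: dpolyX.
Qed.

Lemma upolyC x c : dpoly (lt^~ x) c -> exists c', upoly x 1 c c'.
Proof.
move=> Pc; have := UCons (UNil x) Pc.
have -> : (fun t => 0 + c t * u x t ^+ 0) = c.
  by apply/funext => t; rewrite add0r mulr1.
by eexists; eassumption.
Qed.

Lemma upoly_leq x n m f f' : (n <= m)%N -> upoly x n f f' -> upoly x m f f'.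
Proof.
move=> /subnK <-; elim: (m - n)%N => // k IH /IH fk.
have := UCons fk (DConst _ 0).
by congr upoly; apply/funext => t; rewrite mul0r ?mul0rn addr0.
Qed.

Lemma upolyD x n f f' g g' : upoly x n f f' -> upoly x n g g' ->
  upoly x n (fun t => f t + g t) (fun t => f' t + g' t).
Proof.
move=> fn; elim: fn g g' => {n f f'} [|n f f' c fn IH Pc] g g' gn; inversion_clear gn.
  by have := UNil x; congr upoly; apply/funext => t; rewrite addr0.
have := UCons (IH _ _ H) (DAdd Pc H0).
by congr upoly; apply/funext => t; rewrite mulrDl ?mulrnDl addrACA.
Qed.

Lemma upolyMc x n f f' c : dpoly (lt^~ x) c -> upoly x n f f' ->
  upoly x n (fun t => c t * f t) (fun t => c t * f' t).
Proof.
move=> Pc; elim=> {n f f'} [|n f f' b fn IH Pb].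
  by have := UNil x; congr upoly; apply/funext => t; rewrite mulr0.
have := UCons IH (DMul Pc Pb).
by congr upoly; apply/funext => t; rewrite mulrDr ?mulrnAr mulrA.
Qed.

Lemma upolyMu x n f f' : upoly x n f f' ->
  exists g', upoly x n.+1 (fun t => u x t * f t) g'.
Proof.
elim=> {n f f'} [|n f f' c fn [g' IH] Pc].
  have [g' g1] := upolyC (DConst (lt^~ x) 0); exists g'.
  by have := g1; congr upoly; apply/funext => t; rewrite mulr0.
eexists; have := UCons IH Pc; congr upoly; apply/funext => t.
by rewrite mulrDr exprS mulrCA.
Qed.

Lemma upolyMX x k n f f' : upoly x n f f' ->
  exists g', upoly x (k + n) (fun t => u x t ^+ k * f t) g'.
Proof.
move=> fn; elim: k => [|k [g' IH]].
  by exists f'; have := fn; congr upoly; apply/funext => t; rewrite mul1r.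
have [h' hn] := upolyMu IH; exists h'; have := hn.
by congr upoly; apply/funext => t; rewrite exprS mulrA.
Qed.

Lemma upolyM x n m f f' g g' : upoly x n f f' -> upoly x m g g' ->
  exists k h', upoly x k (fun t => f t * g t) h'.
Proof.
move=> fn gm; elim: fn => {n f f'} [|n f f' c fn [k [h' IH]] Pc].
  exists 0, (fun=> 0); have := UNil x.
  by congr upoly; apply/funext => t; rewrite mul0r.
have [k' hk] := upolyMX n (upolyMc Pc gm).
exists (maxn k (n + m)); eexists.
have := upolyD (upoly_leq (leq_maxl k (n + m)) IH)
               (upoly_leq (leq_maxr k (n + m)) hk).
by congr upoly; apply/funext => t; ring.
Qed.

Lemma dpoly_upoly x f : dpoly (le x) f -> exists n f', upoly x n f f'.
Proof.
elim=> [c|y [->|yx]|g h _ [n [g' gn]] _ [m [h' hm]]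
       |g h _ [n [g' gn]] _ [m [h' hm]]].
- by have [c' ?] := upolyC (DConst (lt^~ x) c); exists 1, c'.
- have [c' /upolyMu [g' x2]] := upolyC (DConst (lt^~ x) 1).
  exists 2, g'; have := x2.
  by congr upoly; apply/funext => t; rewrite mulr1.
- by have [c' ?] := upolyC (DVar yx); exists 1, c'.
- exists (maxn n m); eexists.
  exact: upolyD (upoly_leq (leq_maxl n m) gn) (upoly_leq (leq_maxr n m) hm).
- exact: upolyM gn hm.
Qed.

Lemma upoly_deriv x n f f' : upoly x n f f' -> exists f'', upoly x n.-1 f' f''.
Proof.
elim=> {n f f'} [|n f f' c fn [f'' IH] Pc]; first by exists (fun=> 0); exact: UNil.
case: n fn IH => [|n] fn IH /=.
  exists f''; have := IH; congr upoly; apply/funext => t.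
  by rewrite mulr0n addr0.
eexists; have := UCons IH (dpolyMn n.+1 Pc); congr upoly.
by apply/funext => t; rewrite mulrnAl.
Qed.

(** Differentiating the powers of [u x] gives the formal derivative times [u (shift i x)];
    differentiating the coefficients only meets variables [y] and [shift i y] with [y] below [x]. So
    [delta i f] is linear in its new leader, with the separant of [f] as coefficient. *)
Lemma upoly_delta x n f f' i : upoly x n f f' ->
  exists r, dpoly (lt^~ (shift i x)) r /\
    forall t, delta i (f t) = f' t * u (shift i x) t + r t.
Proof.
elim=> {n f f'} [|n f f' c fn [r [Pr IH]] Pc].
  by exists (fun=> 0); split=> [|t]; [exact: DConst|rewrite delta0 mul0r addr0].
exists (fun t => r t + delta i (c t) * u x t ^+ n); split=> [|t].
  apply: DAdd => //; apply: DMul; last exact/dpolyX/DVar.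
  apply: dpoly_delta Pc => y yx; split; last exact: shift_mono.
  exact: lt_trans yx (lt_shift i x).
rewrite deltaD IH deltaM deltaX u_shift mulrDl !mulrnAl mulrnAr mulrA.
by rewrite (addrC (_ * u x t ^+ n)) addrACA.
Qed.

(** * Noetherian point sets and maximal bad sets *)

Definition null V f := forall t, V t -> f t = 0.

Definition zeros V f : T -> Prop := fun t => V t /\ f t = 0.

(** Noetherianity of [V] for the topology cut out by differential polynomials, stated as a finite
    basis property. *)
Definition noeth V := forall S : F -> Prop,
  (forall f, S f -> dpoly (fun=> True) f) ->
  exists s : seq F, List.Forall S s /\
    forall t, V t -> List.Forall (fun f => f t = 0) s -> forall f, S f -> f t = 0.

Lemma noethS V W : (forall t, V t -> W t) -> noeth W -> noeth V.
Proof.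
move=> VW nW S /nW [s [Ss sW]]; exists s; split=> // t /VW; exact: sW.
Qed.

Lemma noethU V W X : noeth V -> noeth W -> (forall t, X t -> V t \/ W t) -> noeth X.
Proof.
move=> nV nW XVW S SP; have [s [Ss sV]] := nV S SP; have [r [Sr rW]] := nW S SP.
exists (s ++ r); split; first exact/List.Forall_app.
by move=> t /XVW [Vt|Wt] /List.Forall_app [s0 r0]; [exact: sV|exact: rW].
Qed.

Lemma noeth_empty V : (forall t, ~ V t) -> noeth V.
Proof. by move=> V0 S _; exists [::]; split=> // t /V0. Qed.

(* On such a V, u x is algebraic, and its proper derivatives are rational,     *)
(* over the smaller variables.                                                 *)
Definition lead V x d := exists f f' c,
  [/\ upoly x d f f', dpoly (lt^~ x) c,
      null V (fun t => f t + c t * u x t ^+ d),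
      forall t, V t -> c t <> 0 &
      forall t, V t -> f' t + c t * u x t ^+ d.-1 *+ d <> 0].

Definition cover V x d := exists y e w,
  [/\ lead V y e, x = foldr shift y w & (e <= d)%N].

Lemma coverS V W x d : (forall t, W t -> V t) -> cover V x d -> cover W x d.
Proof.
move=> WV [y [e [w [[f [f' [c [fe Pc f0 c0 s0]]]] -> ed]]]].
exists y, e, w; split=> //; exists f, f', c.
by split=> // t /WV; [exact: f0|exact: c0|exact: s0].
Qed.

(** Otherwise dependent choice gives a descending chain of bad sets [A n] and pairs [s n] covered by
    [A n.+1] but not by [A n]. Dickson's lemma finds [i < j] with [s j] above [s i]; since shrinking
    a set preserves covers, [A j] already covers [s j]. *)
Lemma max_cover : ~ noeth (fun=> True) -> exists V, ~ noeth V /\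
  forall W, (forall t, W t -> V t) -> ~ noeth W ->
  forall x d, cover W x d -> cover V x d.
Proof.
move=> bT; apply: contrapT => noV.
have step (A : {V | ~ noeth V}) : {B : {V | ~ noeth V} * (J * nat) |
    [/\ forall t, sval B.1 t -> sval A t, cover (sval B.1) B.2.1 B.2.2 &
        ~ cover (sval A) B.2.1 B.2.2]}.
  apply: cid; case: A => V bV /=; apply: contrapT => noB; apply: noV.
  exists V; split=> // W WV bW x d cW; apply: contrapT => cV; apply: noB.
  by exists (exist _ W bW, (x, d)).
pose A n := iter n (fun A => (sval (step A)).1) (exist (fun V => ~ noeth V) _ bT).
pose s n := (sval (step (A n))).2.
have A_S n : [/\ forall t, sval (A n.+1) t -> sval (A n) t,
    cover (sval (A n.+1)) (s n).1 (s n).2 & ~ cover (sval (A n)) (s n).1 (s n).2].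
  exact: svalP (step (A n)).
have A_mono i j : (i <= j)%N -> forall t, sval (A j) t -> sval (A i) t.
  move=> /subnK <-; elim: (j - i)%N => // k IH t; rewrite addSn.
  by have [sub _ _] := A_S (k + i)%N; move=> /sub /IH.
have [i [j [w [ij sj1 sj2]]]] := dickson s.
have [_ si _] := A_S i; have [_ _] := A_S j; apply.
have [y [e [v [lV s1 s2]]]] := coverS (A_mono _ _ ij) si.
exists y, e, (w ++ v); split=> //; first by rewrite sj1 s1 foldr_cat.
exact: leq_trans s2 sj2.
Qed.

(** The first differentiation of the relation puts its separant [S] in front of the new leader; each
    further one keeps [S] there and sends the derivative of [S] into the lower terms. *)
Lemma lead_derivative V x d i w : lead V x d ->
  let z := shift i (foldr shift x w) in
  exists S r, [/\ dpoly (lt^~ z) S, dpoly (lt^~ z) r,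
    forall t, V t -> S t <> 0 & forall t, V t -> S t * u z t + r t = 0].
Proof.
move=> [f [f' [c [fd Pc f0 _ s0]]]].
have fcd := UCons fd Pc; have [_ PS] := upoly_dpoly fcd.
set S := fun t => f' t + c t * u x t ^+ d.-1 *+ d in fcd PS s0.
have ltS v k : dpoly (lt^~ (shift k (foldr shift x v))) S.
  apply: dpolyS PS => y; have xz := le_lt_shift k (foldr_shift_le x v).
  by case=> [->//|yx]; exact: lt_trans yx xz.
move=> z; exists S; rewrite {}/z.
elim: w i => [|k w IH] i /=.
  have [r [Pr Er]] := upoly_delta i fcd; exists r; split=> //.
    exact: (ltS [::]).
  by move=> t Vt; rewrite -Er f0 ?delta0.
have [r [P_S Pr _ S0]] := IH k; set z := shift k _ in P_S Pr S0 *.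
have up y : lt y z -> lt y (shift i z) /\ lt (shift i y) (shift i z).
  by move=> yz; split; [exact: lt_trans yz (lt_shift _ _)|exact: shift_mono].
exists (fun t => delta i (S t) * u z t + delta i (r t)); split=> //.
- exact: (ltS (k :: w)).
- apply: DAdd; last exact: dpoly_delta up _.
  by apply: DMul; [exact: dpoly_delta up _|exact: DVar].
- move=> t Vt; have := congr1 (delta i) (S0 t Vt).
  by rewrite delta0 deltaD deltaM u_shift => <-; ring.
Qed.

(** Substitution of [- r / S] for [u x], with denominators cleared by a power of [S]. *)
Lemma upoly_eliminate V x n f f' S r : upoly x n f f' ->
    dpoly (lt^~ x) S -> dpoly (lt^~ x) r -> null V (fun t => S t * u x t + r t) ->
  exists k g, dpoly (lt^~ x) g /\ forall t, V t -> S t ^+ k * f t = g t.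
Proof.
move=> fn PS Pr S0; elim: fn => {n f f'} [|n f f' c fn [k [g [Pg kg]]] Pc].
  by exists 0, (fun=> 0); split=> [|t _]; [exact: DConst|rewrite mulr0].
exists (k + n)%N, (fun t => S t ^+ n * g t + S t ^+ k * c t * (- r t) ^+ n).
split=> [|t Vt].
  apply: DAdd; first by apply: DMul => //; exact: dpolyX.
  apply: DMul; last exact/dpolyX/dpolyN.
  by apply: DMul => //; exact: dpolyX.
have <- : S t * u x t = - r t by apply/eqP; rewrite -addr_eq0 S0.
by rewrite -kg // exprMn exprD; ring.
Qed.

Lemma null_mul V f g h : (forall t, V t -> g t <> 0) ->
  (forall t, V t -> g t * f t = h t) -> null V h -> null V f.
Proof.
by move=> g0 E h0 t Vt; have := h0 t Vt; rewrite -E // => /C_domain [/(g0 t Vt)|].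
Qed.

Lemma null_or_noeth_mul V f g h : (forall t, V t -> g t <> 0) ->
    (forall t, V t -> g t * f t = h t) ->
  null V h \/ noeth (zeros V h) -> null V f \/ noeth (zeros V f).
Proof.
move=> g0 E [h0|hn]; [left; exact: null_mul g0 E h0|right].
by apply: noethS hn => t [Vt f0]; split=> //; rewrite -E // f0 mulr0.
Qed.

Section MaximalCover.
Variable V : T -> Prop.
Hypothesis V_max : forall W, (forall t, W t -> V t) -> ~ noeth W ->
  forall x d, cover W x d -> cover V x d.

(** The zeros of the leading coefficient are handled by hypothesis, those of the separant by
    induction on [d]. On the remaining zeros [W] the polynomial itself records its leader and
    degree, so if [W] were bad, maximality would make [V] cover this pair. *)
Lemma noeth_zeros_reduced x :
    (forall c, dpoly (lt^~ x) c -> null V c \/ noeth (zeros V c)) ->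
  forall d f f' c, upoly x d f f' -> dpoly (lt^~ x) c -> ~ null V c ->
    (d = 0)%N \/ ~ cover V x d ->
  noeth (zeros V (fun t => f t + c t * u x t ^+ d)).
Proof.
move=> IHx; elim=> [|d IHd] f f' c fd Pc c0 redd.
  inversion_clear fd; have [//|cn] := IHx c Pc; apply: noethS cn => t [Vt].
  by rewrite add0r mulr1.
set h := fun t => _; case: redd => // not_cov; apply: contrapT => bad_h.
have [//|cn] := IHx c Pc.
have [f'' f'd] := upoly_deriv fd.
(* The separant has leading coefficient [c *+ d.+1], not null because [C] is torsion free, and a
   cover of [(x, d)] would also cover [(x, d.+1)]. *)
have sn : noeth (zeros V (fun t => f' t + c t *+ d.+1 * u x t ^+ d)).
  apply: IHd f'd (dpolyMn d.+1 Pc) _ _.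
    by move=> c0'; apply: c0 => t /c0' /C_torsion_free.
  by right=> -[y [e [w [ly xw ed]]]]; apply: not_cov; exists y, e, w; rewrite leqW.
pose W t := [/\ zeros V h t, c t <> 0 & f' t + c t * u x t ^+ d *+ d.+1 <> 0].
have bad_W : ~ noeth W.
  move=> Wn; apply: bad_h; apply: noethU Wn (noethU cn sn _) _; first by move=> t; exact.
  move=> t [Vt ht]; have [ct|ct] := pselect (c t = 0); first by right; left.
  have [st|st] := pselect (f' t + c t * u x t ^+ d *+ d.+1 = 0).
    by right; right; split=> //; rewrite mulrnAl.
  by left.
apply/not_cov/(V_max _ bad_W) => [t [[]] //|].
exists x, d.+1, [::]; split=> //; exists f, f', c; split=> // t [] //.
by case.
Qed.

Lemma null_or_noeth x f : dpoly (le x) f -> null V f \/ noeth (zeros V f).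
Proof.
elim/(well_founded_ind lt_wf): x f => x IHx f Pf.
have {}IHx c : dpoly (lt^~ x) c -> null V c \/ noeth (zeros V c).
  move=> /dpoly_le [[a ->]|[y [yx /(IHx _ yx) //]]].
  have [->|a0] := pselect (a = 0); first by left.
  by right; apply: noeth_empty => t [].
have [n [f' fn]] := dpoly_upoly Pf.
have [[y [d [i [w [ly xw]]]]]|no_lead] :=
    pselect (exists y d i w, lead V y d /\ x = shift i (foldr shift y w)).
  have := lead_derivative i w ly; rewrite -xw => -[S [r [PS Pr S0 Sr]]].
  have [k [g [Pg kg]]] := upoly_eliminate fn PS Pr Sr.
  apply: null_or_noeth_mul kg (IHx g Pg) => t Vt.
  elim: k => [|k IHk].
    rewrite expr0 => one0; apply: (S0 t Vt).
    by rewrite -[S t]mulr1 one0 mulr0.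
  by rewrite exprS => /C_domain [/(S0 t Vt)|].
elim: n f f' fn {Pf} => [|n IHn] f f' fn.
  by inversion_clear fn; left.
inversion_clear fn as [|? g g' c gn Pc].
have [c0|c0] := pselect (null V c).
  have [g0|gn0] := IHn _ _ gn.
    by left=> t Vt; rewrite g0 // c0 // mul0r addr0.
  by right; apply: noethS gn0 => t [Vt]; rewrite c0 // mul0r addr0.
have [redn|] := pselect ((n = 0)%N \/ ~ cover V x n).
  by right; exact: noeth_zeros_reduced gn Pc c0 redn.
move=> /not_orP [_ /contrapT [y [e [[|i w] [lx xw en]]]]]; last first.
  by case: no_lead; exists y, e, i, w.
move: lx; rewrite /= in xw; rewrite -{y}xw => -[F [F' [I0 [Fe PI F0 I0V _]]]].
(* Pseudo-division: [I0] times the polynomial, minus [c * u x ^ (n - e)] times the relation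
   [F + I0 * u x ^ e], which is null on [V], has degree below [n]. *)
have [h' hn] := upolyMX (n - e) (upolyMc (dpolyN Pc) Fe).
rewrite subnK // in hn.
have kn := upolyD (upolyMc PI gn) hn.
apply: null_or_noeth_mul I0V _ (IHn _ _ kn) => t Vt.
have Ft : F t = - (I0 t * u x t ^+ e) by apply/eqP; rewrite -addr_eq0 F0.
have -> : u x t ^+ n = u x t ^+ (n - e) * u x t ^+ e by rewrite -exprD subnK.
by rewrite Ft; ring.
Qed.

End MaximalCover.

Theorem ritt_raudenbush : noeth (fun=> True).
Proof.
apply: contrapT => /max_cover [V [bV V_max]]; apply: bV => S SP.
have [nullS|/existsNP [f /not_implyP [Sf f0]]] :=
    pselect (forall f, S f -> null V f).
  by exists [::]; split=> // t Vt _ f Sf; exact: nullS.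
have [//|fn] : null V f \/ noeth (zeros V f).
  have [[c ->]|[x [_ fx]]] := dpoly_le (SP f Sf); last exact: null_or_noeth fx.
  have [->|c0] := pselect (c = 0); first by left.
  by right; apply: noeth_empty => t [].
have [s [Ss s0]] := fn S SP; exists (f :: s); split; first exact: List.Forall_cons.
move=> t Vt fs0; have [ft0 st0] := (List.Forall_inv fs0, List.Forall_inv_tail fs0).
exact: s0.
Qed.

(** * Chains of closed sets *)

(** Equivalently, [V] is the zero set of some system of differential polynomials; this form avoids
    choosing the system. *)
Definition dpoly_closed V := forall t,
  (forall f, dpoly (fun=> True) f -> null V f -> f t = 0) -> V t.

(** For a union, two polynomials separating [t] from either piece have a product separating it from
    both, as [C] is a domain; the constant 1 settles the empty set. *)
Lemma closed_from_dpoly_closed (B : (T -> Prop) -> Prop) : (1 : C) <> 0 ->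
  (forall V, B V -> dpoly_closed V) -> forall V, closed_from B V -> dpoly_closed V.
Proof.
move=> one0 BP V; elim=> {V} [V /BP //||V W _ IHV _ IHW|E _ IH|V W _ IH VW] t.
- by move=> /(_ _ (DConst _ 1)) t0; apply: one0; apply: t0.
- move=> t0; apply: contrapT => /not_orP [nVt nWt].
  have [f [Pf f0 ft]] : exists f, [/\ dpoly (fun=> True) f, null V f & f t <> 0].
    apply: contrapT => no_f; apply/nVt/IHV => f Pf f0; apply: contrapT => ft.
    by apply: no_f; exists f.
  have [g [Pg g0 gt]] : exists f, [/\ dpoly (fun=> True) f, null W f & f t <> 0].
    apply: contrapT => no_f; apply/nWt/IHW => g Pg g0; apply: contrapT => gt.
    by apply: no_f; exists g.
  have /C_domain [//|//] : f t * g t = 0.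
  by apply: (t0 _ (DMul Pf Pg)) => a [/f0|/g0] ->; rewrite ?mul0r ?mulr0.
- move=> t0 V EV; apply: (IH V EV) => f Pf f0; apply: t0 => // a /(_ V EV).
  exact: f0.
- by move=> t0; apply/VW/IH => f Pf f0; apply: t0 => // a /VW; exact: f0.
Qed.

Theorem dpoly_closed_noetherian (B : (T -> Prop) -> Prop) : (1 : C) <> 0 ->
  (forall V, B V -> dpoly_closed V) -> noetherian_topology (closed_from B).
Proof.
move=> one0 BP V V_closed V_anti.
have V_mono i j : (i <= j)%N -> forall t, V j t -> V i t.
  move=> /subnK <-; elim: (j - i)%N => // k IH t; rewrite addSn => /V_anti.
  exact: IH.
(* The polynomials that vanish on some member of the chain. A finite subsystem with the same zeros
   vanishes on a single [V N], hence so do they all. *)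
pose S f := dpoly (fun=> True) f /\ exists n, null (V n) f.
have [|s [Ss s0]] := @ritt_raudenbush S; first by move=> f [].
have [N VN] : exists N, List.Forall (null (V N)) s.
  elim: s Ss {s0} => [|f s IH] Ss; first by exists 0%N.
  have [_ [n nf]] := List.Forall_inv Ss.
  have [N VN] := IH (List.Forall_inv_tail Ss).
  exists (maxn n N); apply: List.Forall_cons.
    by move=> t /(V_mono _ _ (leq_maxl n N)); exact: nf.
  apply: List.Forall_impl VN => g gN t /(V_mono _ _ (leq_maxr n N)); exact: gN.
exists N => n Nn t; split; first exact: V_mono.
move=> Vt; apply: (closed_from_dpoly_closed one0 BP (V_closed n)) => f Pf f0.
apply: s0 => //; last by split=> //; exists n.
by apply: List.Forall_impl VN => g; exact.
Qed.

End RittRaudenbush.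
(** * Dickson's lemma for derivative indices *)

(** Each chosen term is a minimum of the sequence over the tail that remains. *)
Lemma nondecreasing_subsequence (s : nat -> nat) : exists phi : nat -> nat,
  {homo phi : i j / (i < j)%N} /\ {homo s \o phi : i j / (i <= j)%N}.
Proof.
have next N : {n | (N <= n)%N /\ forall k, (N <= k)%N -> (s n <= s k)%N}.
  apply: cid; have exs : exists v, `[< exists2 n, (N <= n)%N & s n = v >].
    by exists (s N); apply/asboolP; exists N.
  case: (ex_minnP exs) => v /asboolP [n Nn sn] v_min.
  exists n; split=> // k Nk; rewrite sn; apply: v_min.
  by apply/asboolP; exists k.
pose phi := fix phi k := if k is k'.+1 then sval (next (phi k').+1) else sval (next 0).
have phi_ltS k : (phi k < phi k.+1)%N by case: (svalP (next (phi k).+1)).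
exists phi; split; first exact: (homo_ltn ltn_trans).
apply: (homo_leq leqnn leq_trans) => k /=.
case: k (phi_ltS k) => [|k] lt_k; first by case: (svalP (next 0)) => _; exact.
case: (svalP (next (phi k).+1)) => le_k; apply.
exact: leq_trans le_k (ltnW lt_k).
Qed.

Lemma nondecreasing_common_subsequence (r : seq (nat -> nat)) : exists phi : nat -> nat,
  {homo phi : i j / (i < j)%N} /\
  List.Forall (fun s => {homo s \o phi : i j / (i <= j)%N}) r.
Proof.
elim: r => [|s r [phi [phi_lt IH]]]; first by exists id; split.
have [psi [psi_lt s_le]] := nondecreasing_subsequence (s \o phi).
exists (phi \o psi); split=> [i j /psi_lt /phi_lt //|].
apply: List.Forall_cons => //; apply: List.Forall_impl IH => g g_le i j ij.
apply: g_le; exact: ltnW_homo psi_lt _ _ ij.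
Qed.

Section DerivativeIndices.
Variables n p : nat.
Local Notation J := ('I_n * 'X_{1..p})%type.

Definition shiftd (i : 'I_p) (x : J) : J := (x.1, (x.2 + U_(i))%MM).

(** Derivative multi-indices are compared first, in the monomial order, so that differentiation
    raises the rank; the unknowns only break ties. *)
Definition rank_lt (x y : J) : Prop :=
  (x.2 < y.2)%O \/ x.2 = y.2 /\ (x.1 < y.1)%N.

Lemma rank_lt_wf : well_founded rank_lt.
Proof.
suff accP a j : Acc rank_lt (j, a) by case.
elim/(well_founded_ind (@ltom_wf p)): a j => a IHa j.
have [k] := ubnP (nat_of_ord j); elim: k j => [|k IHk] j; first by rewrite ltn0.
rewrite ltnS => jk.
constructor=> -[i b] [/= ba|/= [-> ij]]; first exact: IHa.
by apply: IHk; exact: leq_trans ij jk.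
Qed.

Lemma rank_lt_trans x y z : rank_lt x y -> rank_lt y z -> rank_lt x z.
Proof.
move=> [xy|[exy xy]] [yz|[eyz yz]].
- by left; exact: lt_trans xy yz.
- by left; rewrite -eyz.
- by left; rewrite exy.
- by right; rewrite exy eyz; split=> //; exact: ltn_trans xy yz.
Qed.

Lemma rank_lt_total x y : [\/ rank_lt x y, x = y | rank_lt y x].
Proof.
case: x y => [i a] [j b]; rewrite /rank_lt /=.
have [ab|ba|->] := ltgtP a b; [by constructor 1; left|by constructor 3; left|].
have [ij|ji|/val_inj ->] := ltngtP i j; first by constructor 1; right.
  by constructor 3; right.
by constructor 2.
Qed.

Lemma rank_lt_shift i x : rank_lt x (shiftd i x).
Proof.
left => /=; rewrite lt_neqAle lemc_addr andbT.
by apply/eqP => /mnmP /(_ i); rewrite mnmDE mnm1E eqxx addn1 => /n_Sn.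
Qed.

Lemma rank_shift_mono i x y : rank_lt x y -> rank_lt (shiftd i x) (shiftd i y).
Proof.
case=> [xy|[exy xy]]; first by left; rewrite /= ltmc_add2l.
by right; rewrite /= exy.
Qed.

Lemma foldr_shiftd (a : 'X_{1..p}) : exists w, forall x : J,
  foldr shiftd x w = (x.1, (x.2 + a)%MM).
Proof.
have [k] := ubnP (mdeg a); elim: k a => // k IHk a /ltnSE ak.
have [a0|/mnmP/existsNP [i ai]] := pselect (a = 0%MM).
  by exists [::] => -[j b]; rewrite a0 addm0.
have Ui : (U_(i) <= a)%MM.
  apply/mnm_lepP => l; rewrite mnm1E; case: eqP => // <-.
  by rewrite lt0n; apply/eqP => ai0; apply: ai; rewrite ai0 mnm0E.
have [|w wP] := IHk (a - U_(i))%MM.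
  by rewrite -(submK Ui) mdegD mdeg1 addn1 in ak.
exists (i :: w) => x; rewrite /= wP /shiftd /=.
by rewrite -addmA submK.
Qed.

Lemma dickson_derivatives (s : nat -> J * nat) : exists i j w,
  [/\ (i < j)%N, (s j).1 = foldr shiftd (s i).1 w & ((s i).2 <= (s j).2)%N].
Proof.
(* Asking both the index of the unknown and its complement to [n] to be nondecreasing forces that
   index to be constant along the subsequence. *)
pose r := [:: fun k => (s k).2; fun k => (s k).1.1 : nat; fun k => (n - (s k).1.1)%N]
  ++ [seq fun k => (s k).1.2 i | i <- enum 'I_p].
have [phi [phi_lt /List.Forall_forall r_le]] := nondecreasing_common_subsequence r.
have {}r_le g : List.In g r -> (g (phi 0%N) <= g (phi 1%N))%N by move=> /r_le; exact.
exists (phi 0%N), (phi 1%N).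
have le2 : ((s (phi 0%N)).1.2 <= (s (phi 1%N)).1.2)%MM.
  apply/mnm_lepP => i; apply: (r_le (fun k => (s k).1.2 i)).
  do 3 right.
  have : i \in enum 'I_p by rewrite mem_enum.
  elim: (enum _) => //= l e IH; rewrite inE => /predU1P [->|/IH]; first by left.
  by right.
have eq1 : (s (phi 0%N)).1.1 = (s (phi 1%N)).1.1.
  apply/val_inj/anti_leq/andP; split.
    exact: (r_le (fun k => (s k).1.1 : nat) (or_intror (or_introl erefl))).
  have := r_le (fun k => (n - (s k).1.1)%N) (or_intror (or_intror (or_introl erefl))).
  by rewrite leq_sub2lE // ltnW.
have [w wP] := foldr_shiftd ((s (phi 1%N)).1.2 - (s (phi 0%N)).1.2)%MM.
exists w; split; [exact: phi_lt| |exact: r_le _ (or_introl erefl)].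
by rewrite wP addmC submK // eq1 -surjective_pairing.
Qed.

End DerivativeIndices.

(** * Subalgebras and free algebras *)

Section Subalgebras.
Variables (R : comNzRingType) (D : nalg R).

(** Subalgebras serve as induction principles: a property stable under the operations and true on
    generators holds everywhere ([free_generated], [coproduct_generated]). *)
Record subalgebra := Subalgebra {
  subalgebra_pred : D -> Prop;
  subalgebra0 : subalgebra_pred 0;
  subalgebra_lin : forall c x y,
    subalgebra_pred x -> subalgebra_pred y -> subalgebra_pred (c *: x + y);
  subalgebra_mul : forall x y,
    subalgebra_pred x -> subalgebra_pred y -> subalgebra_pred (nalg_mul x y)
}.

Variable S : subalgebra.

Definition subalgebra_mem : pred D := fun x => `[< subalgebra_pred S x >].

Lemma subalgebra_submod_closed : submod_closed subalgebra_mem.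
Proof.
split=> [|c x y /asboolP Sx /asboolP Sy]; apply/asboolP.
  exact: subalgebra0.
exact: subalgebra_lin.
Qed.

HB.instance Definition _ :=
  GRing.isSubmodClosed.Build R D subalgebra_mem subalgebra_submod_closed.

Record subalgebra_elt := SubalgebraElt {
  subalgebra_val : D; _ : subalgebra_val \in subalgebra_mem }.

HB.instance Definition _ := [isSub for subalgebra_val].
HB.instance Definition _ := [Choice of subalgebra_elt by <:].
HB.instance Definition _ := [SubChoice_isSubZmodule of subalgebra_elt by <:].
HB.instance Definition _ := [SubZmodule_isSubLmodule of subalgebra_elt by <:].

Lemma subalgebra_valP c (x y : subalgebra_elt) :
  subalgebra_val (c *: x + y) = c *: subalgebra_val x + subalgebra_val y.
Proof. exact: (@linearP _ _ _ _ (val : subalgebra_elt -> D)). Qed.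

Lemma subalgebra_eltP (x : subalgebra_elt) : subalgebra_pred S (val x).
Proof. by case: x => x /= /asboolP. Qed.

Lemma subalgebra_mulP (x y : subalgebra_elt) :
  nalg_mul (val x) (val y) \in subalgebra_mem.
Proof. by apply/asboolP/subalgebra_mul; exact: subalgebra_eltP. Qed.

Definition subalgebra_eltM (x y : subalgebra_elt) : subalgebra_elt :=
  SubalgebraElt (subalgebra_mulP x y).

Lemma subalgebra_bilinear : bilinear_for *:%R *:%R subalgebra_eltM.
Proof.
case: (nalg_bilinear D) => Dl Dr.
by split=> [z a x y|x a y z]; apply: val_inj; [exact: Dl|exact: Dr].
Qed.

Definition subalgebra_nalg : nalg R := NAlg subalgebra_bilinear.

Lemma subalgebra_val_hom : @is_nalg_hom R subalgebra_nalg D subalgebra_val.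
Proof. by split=> // c x y; exact: subalgebra_valP. Qed.

End Subalgebras.

Section Homs.
Variable R : comNzRingType.
Implicit Types A B D F : nalg R.

Lemma nalg_hom0 A B (f : A -> B) : is_nalg_hom f -> f 0 = 0.
Proof.
case=> fl _; have := fl (-1) 0 0; rewrite scaleN1r oppr0 addr0 => ->.
by rewrite scaleN1r addNr.
Qed.

Lemma nalg_homZ A B (f : A -> B) c x : is_nalg_hom f -> f (c *: x) = c *: f x.
Proof. by move=> fh; have := fh.1 c x 0; rewrite (nalg_hom0 fh) !addr0. Qed.

Lemma nalg_homD A B (f : A -> B) x y : is_nalg_hom f -> f (x + y) = f x + f y.
Proof. by case=> fl _; have := fl 1 x y; rewrite !scale1r. Qed.

Lemma nalg_hom_comp A B D (f : A -> B) (g : B -> D) :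
  is_nalg_hom f -> is_nalg_hom g -> is_nalg_hom (g \o f).
Proof. by case=> fl fm [gl gm]; split=> [c x y|x y] /=; rewrite ?fl ?gl ?fm ?gm. Qed.

Lemma napoly_eval_hom A B (f : A -> B) (v : nat -> A) t : is_nalg_hom f ->
  f (napoly_eval v t) = napoly_eval (f \o v) t.
Proof.
move=> fh; elim: t => //= [s IHs t IHt|c s IHs|s IHs t IHt].
- by rewrite nalg_homD // IHs IHt.
- by rewrite nalg_homZ // IHs.
- by rewrite fh.2 IHs IHt.
Qed.

Lemma in_variety_sub M D (S : subalgebra D) :
  in_variety M D -> in_variety M (subalgebra_nalg S).
Proof.
move=> MD t Mt v; apply: val_inj.
have := napoly_eval_hom v t (subalgebra_val_hom S) => /= ->.
rewrite [RHS](nalg_hom0 (subalgebra_val_hom S)); exact: MD.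
Qed.

Lemma hom_to_subalgebra A D (S : subalgebra D) (h : A -> D) : is_nalg_hom h ->
  (forall x, subalgebra_pred S (h x)) ->
  exists g : A -> subalgebra_nalg S, is_nalg_hom g /\ forall x, val (g x) = h x.
Proof.
move=> [hl hm] hS; have hS' x : h x \in subalgebra_mem S by exact/asboolP.
exists (fun x => SubalgebraElt (hS' x)); split=> //.
have [vl vm] := subalgebra_val_hom S.
split=> [c x y|x y]; apply: val_inj.
  exact: hl.
by rewrite /= hm.
Qed.

(** Sending the generators into [S] and including back gives an endomorphism that fixes them, hence
    the identity by uniqueness. *)
Lemma free_generated M (X : Type) F (i : X -> F) (S : subalgebra F) :
  is_free M i -> (forall x, subalgebra_pred S (i x)) -> forall a, subalgebra_pred S a.
Proof.
move=> [MF Ffree] Si a.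
have Si' x : i x \in subalgebra_mem S by exact/asboolP.
have [h [hh hi _]] := Ffree (subalgebra_nalg S) (fun x => SubalgebraElt (Si' x))
  (in_variety_sub (S := S) MF).
have [k [_ _ k_unique]] := Ffree F i MF.
have vh : is_nalg_hom (val \o h) by exact: nalg_hom_comp hh (subalgebra_val_hom S).
have idh : is_nalg_hom (@id F) by split.
have aE : a = k a by apply: (k_unique id).
have hE : val (h a) = k a by apply: (k_unique (val \o h)) => // x; rewrite /= hi.
rewrite aE -hE.
exact: subalgebra_eltP.
Qed.

Lemma coproduct_generated M A F D (iA : A -> D) (iF : F -> D) (S : subalgebra D) :
    is_coproduct M iA iF ->
    (forall a, subalgebra_pred S (iA a)) -> (forall x, subalgebra_pred S (iF x)) ->
  forall d, subalgebra_pred S d.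
Proof.
move=> [MD hA hF Dcop] SA SF d.
have [gA [hgA gAE]] := hom_to_subalgebra hA SA.
have [gF [hgF gFE]] := hom_to_subalgebra hF SF.
have [h [hh hiA hiF _]] := Dcop _ _ _ (in_variety_sub (S := S) MD) hgA hgF.
have [k [_ _ _ k_unique]] := Dcop D iA iF MD hA hF.
have vh : is_nalg_hom (val \o h) by exact: nalg_hom_comp hh (subalgebra_val_hom S).
have idh : is_nalg_hom (@id D) by split.
have dE : d = k d by apply: (k_unique id).
have hE : val (h d) = k d.
  by apply: (k_unique (val \o h)) => // x; rewrite /= ?hiA ?hiF ?gAE ?gFE.
rewrite dE -hE.
exact: subalgebra_eltP.
Qed.

Fixpoint napoly_rename (s : nat -> nat) (t : napoly R) : napoly R :=
  match t with
  | PVar n => PVar (s n)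
  | PAdd t1 t2 => PAdd (napoly_rename s t1) (napoly_rename s t2)
  | PScale c t1 => PScale c (napoly_rename s t1)
  | PMul t1 t2 => PMul (napoly_rename s t1) (napoly_rename s t2)
  end.

Lemma napoly_eval_rename A (v : nat -> A) s t :
  napoly_eval v (napoly_rename s t) = napoly_eval (v \o s) t.
Proof. by elim: t => //= [t1 -> t2 ->|c t1 ->|t1 -> t2 ->]. Qed.

Lemma eq_napoly_eval A (v w : nat -> A) t :
  v =1 w -> napoly_eval v t = napoly_eval w t.
Proof. by move=> vw; elim: t => //= [t1 -> t2 ->|c t1 ->|t1 -> t2 ->]. Qed.

(** The two valuations are interleaved, [v] on even and [w] on odd variables. *)
Lemma napoly_eval_combine (X : Type) A (f : X -> A) (v w : nat -> X) t1 t2 :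
  exists (u : nat -> X) s1 s2,
    napoly_eval (f \o v) t1 = napoly_eval (f \o u) s1 /\
    napoly_eval (f \o w) t2 = napoly_eval (f \o u) s2.
Proof.
exists (fun k => if odd k then w k./2 else v k./2),
  (napoly_rename double t1), (napoly_rename (fun k => k.*2.+1) t2).
split; rewrite napoly_eval_rename; apply: eq_napoly_eval => k /=.
  by rewrite odd_double doubleK.
by rewrite odd_double /= uphalf_double.
Qed.

Lemma free_napoly M (X : Type) F (i : X -> F) (x0 : X) : is_free M i ->
  forall a, exists v t, a = napoly_eval (i \o v) t.
Proof.
move=> Ffree.
have S0 : exists v t, 0 = napoly_eval (i \o v) t.
  (* [napoly] has no constant for zero, so zero is written as a null multiple of a variable, which
     takes some [x0]. *)
  by exists (fun=> x0), (PScale 0 (PVar 0%N)); rewrite /= scale0r.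
have Sl c x y : (exists v t, x = napoly_eval (i \o v) t) ->
    (exists v t, y = napoly_eval (i \o v) t) ->
    exists v t, c *: x + y = napoly_eval (i \o v) t.
  move=> [v [t ->]] [w [s ->]].
  have [u [t' [s' [-> ->]]]] := napoly_eval_combine i v w t s.
  by exists u, (PAdd (PScale c t') s').
have Sm x y : (exists v t, x = napoly_eval (i \o v) t) ->
    (exists v t, y = napoly_eval (i \o v) t) ->
    exists v t, nalg_mul x y = napoly_eval (i \o v) t.
  move=> [v [t ->]] [w [s ->]].
  have [u [t' [s' [-> ->]]]] := napoly_eval_combine i v w t s.
  by exists u, (PMul t' s').
apply: (free_generated (S := Subalgebra S0 Sl Sm) Ffree) => x.
by exists (fun=> x), (PVar 0%N).
Qed.

(** The element is the value of a nonassociative polynomial at generators; if every homomorphism to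
    [L] kills it, the polynomial is an identity of [L], hence of [A]. Without generators [A] is
    zero. *)
Lemma free_Var_separated (L A : nalg R) (X : Type) (i : X -> A) a :
    is_free (Var L) i ->
    (forall h : A -> L, is_nalg_hom h -> h a = 0) ->
  a = 0.
Proof.
move=> Afree a0; have [[x0 _]|noX] := pselect (exists x : X, True); last first.
  have S0 : (0 : A) = 0 by [].
  have Sl c (x y : A) : x = 0 -> y = 0 -> c *: x + y = 0.
    by move=> -> ->; rewrite scaler0 addr0.
  have [Al _] := nalg_bilinear A.
  have Sm (x y : A) : x = 0 -> y = 0 -> nalg_mul x y = 0.
    by move=> -> ->; have := Al 0 (-1) 0 0; rewrite /= !scaleN1r oppr0 addr0 addNr.
  apply: (free_generated (S := Subalgebra S0 Sl Sm) Afree) => x.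
  by case: noX; exists x.
have [v [t aE]] := free_napoly x0 Afree a.
(* Equal variables of v are merged so that every valuation of the new        *)
(* polynomial comes from a homomorphism.                                     *)
have sigma k : {l | v l = v k /\ forall j, v j = v k -> (l <= j)%N}.
  apply: cid; have exs : exists l, `[< v l = v k >] by exists k; apply/asboolP.
  case: (ex_minnP exs) => l /asboolP vl l_min; exists l; split=> // j vj.
  by apply/l_min/asboolP.
pose s k := sval (sigma k).
have vs k : v (s k) = v k by case: (svalP (sigma k)).
have s_eq k l : v k = v l -> s k = s l.
  have [vk k_min] := svalP (sigma k); have [vl l_min] := svalP (sigma l).
  move=> vkl; apply/anti_leq/andP; split.
    by apply: k_min; rewrite vkl.
  by apply: l_min; rewrite -vkl.
have [AL Auniv] := Afree.
have Lt : satisfies L (napoly_rename s t).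
  move=> w; rewrite napoly_eval_rename.
  have [g gE] : exists g : X -> L, forall k, g (v k) = w (s k).
    have G x : {y | forall k, v k = x -> y = w (s k)}.
      apply: cid; have [[l <-]|no] := pselect (exists l, v l = x).
        by exists (w (s l)) => k /s_eq ->.
      by exists 0 => k vk; case: no; exists k.
    by exists (fun x => sval (G x)) => k; exact: (svalP (G (v k))).
  have LL : in_variety (Var L) L by [].
  have [h [hh hi _]] := Auniv L g LL; rewrite -(a0 h hh) aE napoly_eval_hom //.
  by apply: eq_napoly_eval => k /=; rewrite hi gE.
rewrite aE -(AL _ Lt (i \o v)) napoly_eval_rename.
by apply: eq_napoly_eval => k /=; rewrite vs.
Qed.

End Homs.

(** * Functions that are polynomial along lines *)

Section PolynomialOnLines.
Variables (E : zmodType) (K : idomainType).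
Hypothesis K_char0 : forall k : nat, k.+1%:R <> 0 :> K.

(** Natural parameters [s] suffice to determine the polynomial in characteristic zero, and additive
    maps of [K] commute with multiplication by them, so that derivations preserve the property
    ([line_poly_comp]). *)
Definition line_poly (h : E -> K) : Prop := forall v w,
  exists p : {poly K}, forall s : nat, h (v + w *+ s) = p.[s%:R].

Lemma line_poly_cst a : line_poly (fun=> a).
Proof. by move=> v w; exists a%:P => s; rewrite hornerC. Qed.

Lemma line_polyB f g : line_poly f -> line_poly g -> line_poly (fun v => f v - g v).
Proof.
move=> fP gP v w; have [[p pE] [q qE]] := (fP v w, gP v w).
by exists (p - q) => s; rewrite hornerD hornerN -pE -qE.
Qed.

Lemma line_polyD f g : line_poly f -> line_poly g -> line_poly (fun v => f v + g v).
Proof.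
move=> fP gP v w; have [[p pE] [q qE]] := (fP v w, gP v w).
by exists (p + q) => s; rewrite hornerD -pE -qE.
Qed.

Lemma line_polyM f g : line_poly f -> line_poly g -> line_poly (fun v => f v * g v).
Proof.
move=> fP gP v w; have [[p pE] [q qE]] := (fP v w, gP v w).
by exists (p * q) => s; rewrite hornerM -pE -qE.
Qed.

Lemma line_polyMn f n : line_poly f -> line_poly (fun v => f v *+ n).
Proof.
by move=> fP v w; have [p pE] := fP v w; exists (p *+ n) => s; rewrite hornerMn pE.
Qed.

Lemma line_poly_sum n (F : 'I_n -> E -> K) :
  (forall i, line_poly (F i)) -> line_poly (fun v => \sum_i F i v).
Proof.
elim: n F => [|n IH] F FP.
  by move=> v w; exists 0 => s; rewrite big_ord0 horner0.
have := line_polyD (FP ord0) (IH _ (fun i => FP (lift ord0 i))).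
by congr line_poly; apply/funext => v; rewrite big_ord_recl.
Qed.

Definition line_poly_mem : pred (E -> K) := fun h => `[< line_poly h >].

Lemma line_poly_subring_closed : subring_closed line_poly_mem.
Proof.
split=> [|f g /asboolP fP /asboolP gP|f g /asboolP fP /asboolP gP]; apply/asboolP.
- exact: line_poly_cst.
- exact: line_polyB.
- exact: line_polyM.
Qed.

Record line_poly_fun := LinePolyFun {
  line_poly_val : E -> K; _ : line_poly_val \in line_poly_mem }.

HB.instance Definition _ := [isSub for line_poly_val].
HB.instance Definition _ := [Choice of line_poly_fun by <:].
HB.instance Definition _ := GRing.SubChoice_isSubComPzRing.Build (E -> K) line_poly_mem
  line_poly_fun line_poly_subring_closed.

Lemma line_poly_comp (phi : {additive K -> K}) h :
  line_poly h -> line_poly (phi \o h).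
Proof.
move=> hP v w; have [p pE] := hP v w.
exists (\poly_(i < size p) phi p`_i) => s; rewrite /= pE horner_coef horner_poly.
by rewrite raddf_sum; apply: eq_bigr => i _; rewrite -natrX !mulr_natr raddfMn.
Qed.

Lemma line_poly_funP (h : line_poly_fun) : line_poly (val h).
Proof. by case: h => h /= /asboolP. Qed.

Definition line_poly_post (phi : {additive K -> K}) (h : line_poly_fun) :
    line_poly_fun :=
  LinePolyFun (asboolT (line_poly_comp phi (line_poly_funP h))).

Lemma line_poly_funD (f g : line_poly_fun) v : val (f + g) v = val f v + val g v.
Proof. by []. Qed.

Lemma line_poly_funB (f g : line_poly_fun) v : val (f - g) v = val f v - val g v.
Proof. by []. Qed.

Lemma line_poly_funM (f g : line_poly_fun) v : val (f * g) v = val f v * val g v.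
Proof. by []. Qed.

Lemma line_poly_funMn (f : line_poly_fun) n v : val (f *+ n) v = val f v *+ n.
Proof. by rewrite (raddfMn (val : line_poly_fun -> (E -> K))) natmulfctE. Qed.

Lemma line_poly_fun_sum n (F : 'I_n -> line_poly_fun) v :
  val (\sum_i F i) v = \sum_i val (F i) v.
Proof. by rewrite (raddf_sum (val : line_poly_fun -> (E -> K))) fct_sumE. Qed.

Lemma poly_nat_roots (p : {poly K}) : (forall s : nat, p.[s%:R] = 0) -> p = 0.
Proof.
have natr_inj : injective (fun s : nat => s%:R : K).
  move=> i j; wlog ij : i j / (i <= j)%N => [W|].
    by case/orP: (leq_total i j) => [/W //|/W {}W /esym /W].
  move=> /esym /eqP; rewrite -subr_eq0 -natrB // => /eqP.
  case E1: (j - i)%N => [|k] /= => [_|/K_char0 //].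
  by apply/anti_leq; rewrite ij -subn_eq0 E1.
move=> p0; apply/eqP; apply/negPn/negP => /max_poly_roots mr.
pose r := [seq s%:R : K | s <- iota 0 (size p)].
have : (size r < size p)%N.
  apply: mr; first by apply/allP => _ /mapP [s _ ->]; apply/rootP.
  by rewrite map_inj_uniq ?iota_uniq.
by rewrite size_map size_iota ltnn.
Qed.

(** With [a] nonzero at [v] and [b] nonzero at [w], restrict both to the line that passes through
    [v] at 0 and [w] at 1: the product of two nonzero polynomials would vanish at every natural
    number. *)
Lemma line_poly_fun_domain (a b : line_poly_fun) : a * b = 0 -> a = 0 \/ b = 0.
Proof.
move=> ab0; apply: contrapT => /not_orP [a0 b0].
have nz (c : line_poly_fun) : c <> 0 -> exists v, val c v <> 0.
  move=> c0; apply: contrapT => no; apply/c0/val_inj/funext => v.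
  by apply: contrapT => cv; apply: no; exists v.
have [[v av] [w bw]] := (nz a a0, nz b b0).
have [p pE] := line_poly_funP a v (w - v).
have [q qE] := line_poly_funP b v (w - v).
have /eqP : p * q = 0.
  apply: poly_nat_roots => s; rewrite hornerM -pE -qE.
  exact: (congr1 (fun c => val c (v + (w - v) *+ s)) ab0).
rewrite mulf_eq0 => /orP [/eqP p0|/eqP q0].
  by apply: av; have := pE 0%N; rewrite mulr0n addr0 p0 horner0.
by apply: bw; have := qE 1%N; rewrite mulr1n addrC subrK q0 horner0.
Qed.

Lemma line_poly_fun_torsion_free (k : nat) (a : line_poly_fun) :
  a *+ k.+1 = 0 -> a = 0.
Proof.
move=> ak; apply/val_inj/funext => v /=.
have /eqP : val a v * k.+1%:R = 0.
  have := congr1 (fun c => val c v) ak.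
  by rewrite mulr_natr line_poly_funMn.
by rewrite mulf_eq0 => /orP [/eqP|/eqP /K_char0].
Qed.

End PolynomialOnLines.

(** * Free algebras in varieties of vector field algebras *)

Section FreeAlgebrasOfVectorFields.
Variables (R : idomainType) (m : nat).
Hypothesis R_char0 : forall k : nat, k.+1%:R <> 0 :> R.
Local Notation K := {mpoly R[m]}.
Local Notation vf := {ffun 'I_m -> K}.

(* For c = 0 this is the left-symmetric product, for c = 1 the Lie bracket.    *)
Variables (c : nat) (mul : vf -> vf -> vf).
Hypothesis mul_bilinear : bilinear_for *:%R *:%R mul.
Hypothesis mulE : forall v w j,
  mul v w j = \sum_i (v i * (w j)^`M(i) - w i * (v j)^`M(i) *+ c).

Local Notation L := (NAlg mul_bilinear).

Variables (X : Type) (A : nalg R) (gen : X -> A).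
Hypothesis A_free : is_free (Var L) gen.

Lemma mpoly_char0 (k : nat) : k.+1%:R <> 0 :> K.
Proof.
rewrite -(rmorph_nat (@mpolyC m R)) => /eqP.
by rewrite mpolyC_eq0 => /eqP /R_char0.
Qed.

Local Notation E := (X -> L).

Lemma specialize_exists (v : E) :
  {h : A -> L | is_nalg_hom h /\ forall x, h (gen x) = v x}.
Proof.
by apply: cid; have [h [hh hg _]] := A_free.2 L v (fun t Lt => Lt); exists h.
Qed.

Definition specialize (v : E) : A -> L := sval (specialize_exists v).

Lemma specialize_hom v : is_nalg_hom (specialize v).
Proof. exact: (svalP (specialize_exists v)).1. Qed.

Lemma specialize_gen v x : specialize v (gen x) = v x.
Proof. exact: (svalP (specialize_exists v)).2. Qed.

Definition coord_fun (j : 'I_m) (a : A) : E -> K :=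
  fun v => (specialize v a : vf) j.

Local Notation C := (line_poly_fun E K).

Lemma coord_fun_lin j r a b :
  coord_fun j (r *: a + b) = fun v => r%:MP * coord_fun j a v + coord_fun j b v.
Proof.
apply/funext => v; rewrite /coord_fun (specialize_hom v).1 !ffunE.
by rewrite mul_mpolyC.
Qed.

Lemma coord_fun_mul j a b : coord_fun j (nalg_mul a b) = fun v => \sum_i
  (coord_fun i a v * (coord_fun j b v)^`M(i) -
   coord_fun i b v * (coord_fun j a v)^`M(i) *+ c).
Proof. by apply/funext => v; rewrite /coord_fun (specialize_hom v).2 mulE. Qed.

Lemma line_poly_coord j a : line_poly (coord_fun j a).
Proof.
have S0 j' : line_poly (coord_fun j' 0).
  suff -> : coord_fun j' 0 = fun=> 0 by exact: line_poly_cst.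
  by apply/funext => v; rewrite /coord_fun (nalg_hom0 (specialize_hom v)) ffunE.
have Sl r x y : (forall j', line_poly (coord_fun j' x)) ->
    (forall j', line_poly (coord_fun j' y)) ->
    forall j', line_poly (coord_fun j' (r *: x + y)).
  move=> xP yP j'; rewrite coord_fun_lin; apply: line_polyD => //.
  by apply: line_polyM => //; exact: line_poly_cst.
have Sm x y : (forall j', line_poly (coord_fun j' x)) ->
    (forall j', line_poly (coord_fun j' y)) ->
    forall j', line_poly (coord_fun j' (nalg_mul x y)).
  move=> xP yP j'; rewrite coord_fun_mul; apply: line_poly_sum => i.
  apply: line_polyB; last apply: line_polyMn; apply: line_polyM => //.
    exact: (line_poly_comp (mderiv i)).
  exact: (line_poly_comp (mderiv i)).
apply: (free_generated (S := Subalgebra S0 Sl Sm) A_free) => x j' v w.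
exists (((v x : vf) j')%:P + ((w x : vf) j')%:P * 'X) => s.
rewrite /coord_fun specialize_gen addrfctE natmulfctE !ffunE.
by rewrite hornerD hornerM !hornerC hornerX mulr_natr ffunMnE.
Qed.

Definition coord j a : C := LinePolyFun (asboolT (line_poly_coord j a)).

Definition coord_cst (r : R) : C := LinePolyFun (asboolT (line_poly_cst r%:MP)).

Definition deriv (i : 'I_m) : C -> C := line_poly_post (mderiv i).

Definition derivm (a : 'X_{1..m}) : C -> C := line_poly_post (mderivm a).

Lemma derivE i f v : val (deriv i f) v = (val f v)^`M(i).
Proof. by []. Qed.

Lemma derivD i f g : deriv i (f + g) = deriv i f + deriv i g.
Proof.
by apply/val_inj/funext => v; rewrite derivE !line_poly_funD !derivE mderivD.
Qed.

Lemma derivM i f g : deriv i (f * g) = deriv i f * g + f * deriv i g.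
Proof.
apply/val_inj/funext => v.
by rewrite derivE line_poly_funD !line_poly_funM !derivE mderivM.
Qed.

Lemma derivm_shift i a f : derivm (a + U_(i))%MM f = deriv i (derivm a f).
Proof.
apply/val_inj/funext => v; rewrite /= mderivmDm.
by rewrite -mderivmU1m -!mderivmDm addmC.
Qed.

Lemma derivm0 f : derivm 0%MM f = f.
Proof. by apply/val_inj/funext => v; rewrite /= mderivm0m. Qed.

Lemma coord_lin j r a b : coord j (r *: a + b) = coord_cst r * coord j a + coord j b.
Proof. by apply: val_inj; rewrite /= coord_fun_lin. Qed.

Lemma coord0 j : coord j 0 = 0.
Proof.
apply/val_inj/funext => v.
by rewrite /= /coord_fun (nalg_hom0 (specialize_hom v)) ffunE.
Qed.

Lemma coord_mul j a b : coord j (nalg_mul a b) =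
  \sum_i (coord i a * deriv i (coord j b) - coord i b * deriv i (coord j a) *+ c).
Proof.
apply/val_inj/funext => v; rewrite line_poly_fun_sum.
rewrite -[LHS]/(coord_fun j (nalg_mul a b) v) coord_fun_mul.
by apply: eq_bigr => i _; rewrite line_poly_funB line_poly_funMn.
Qed.

(** Every homomorphism to [L] is [specialize v] for its own restriction [v] to the generators. *)
Lemma coord_inj a : (forall j, coord j a = 0) -> a = 0.
Proof.
move=> a0; apply: (free_Var_separated A_free) => h hh.
have [k [kh kg k_unique]] := A_free.2 L (h \o gen) (fun t Lt => Lt).
rewrite (k_unique h hh) // -(k_unique (specialize (h \o gen))); last 2 first.
- exact: specialize_hom.
- by move=> x; rewrite specialize_gen.
apply/ffunP => j; rewrite ffunE.
exact: (congr1 (fun g => val g (h \o gen)) (a0 j)).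
Qed.

Lemma free_equationally_noetherian : equationally_noetherian A.
Proof.
move=> M MA k _ F z F_free D iA iF D_cop _ _.
pose T := {ffun 'I_k -> A}; pose N := #|{: 'I_k * 'I_m}|.
(* The unknowns are the [k * m] coordinates of a point of [A^k], numbered by ['I_N]; [u x] is the
   derivative of unknown [x.1] of multi-index [x.2]. *)
pose u (x : 'I_N * 'X_{1..m}) (a : T) : C :=
  derivm x.2 (coord (enum_val x.1).2 (a (enum_val x.1).1)).
have u_shift i x a : u (shiftd i x) a = deriv i (u x a) by exact: derivm_shift.
have phi_exists (a : T) : {phi : D -> A | [/\ is_nalg_hom phi,
    forall e, phi (iA e) = e & forall j, phi (iF (z j)) = a j]}.
  apply: cid; have [h [hh hz _]] := F_free.2 A a MA.
  have idh : is_nalg_hom (@id A) by split.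
  have [_ _ _ D_univ] := D_cop.
  have [phi [phih phiA phiF _]] := D_univ A id h MA idh hh.
  by exists phi; split=> // j; rewrite phiF hz.
pose phi a := sval (phi_exists a).
have phiP a : [/\ is_nalg_hom (phi a), forall e, phi a (iA e) = e &
    forall j, phi a (iF (z j)) = a j] by exact: svalP (phi_exists a).
(* The coordinates of [f(a)] are differential polynomials in [a]. Such [f] form a subalgebra
   containing the images of [A] and of [F], hence fill [D]. *)
pose good f := forall j, dpoly u (fun=> True) (fun a => coord j (phi a f)).
have good0 : good 0.
  move=> j; have := DConst u (fun=> True) 0; congr dpoly.
  by apply/funext => a; rewrite nalg_hom0 ?coord0 //; case: (phiP a).
have good_lin r f g : good f -> good g -> good (r *: f + g).
  move=> fP gP j.
  have := DAdd (DMul (DConst _ _ (coord_cst r)) (fP j)) (gP j); congr dpoly.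
  by apply/funext => a; case: (phiP a) => [[-> _] _ _]; rewrite coord_lin.
have dpoly_sum n (G : 'I_n -> T -> C) : (forall i, dpoly u (fun=> True) (G i)) ->
    dpoly u (fun=> True) (fun a => \sum_i G i a).
  elim: n G => [|n IH] G GP.
    have := DConst u (fun=> True) 0; congr dpoly.
    by apply/funext => a; rewrite big_ord0.
  have := DAdd (GP ord0) (IH _ (fun i => GP (lift ord0 i))); congr dpoly.
  by apply/funext => a; rewrite big_ord_recl.
have good_deriv f i j : good f ->
    dpoly u (fun=> True) (fun a => deriv i (coord j (phi a f))).
  by move=> fP; apply: (dpoly_delta (derivD) (derivM) u_shift _ (fP j)).
have good_mul f g : good f -> good g -> good (nalg_mul f g).
  move=> fP gP j; have := dpoly_sum _ (fun i a =>
    coord i (phi a f) * deriv i (coord j (phi a g)) +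
    - (coord i (phi a g) * deriv i (coord j (phi a f)) *+ c)).
  have -> : (fun a => coord j (phi a (nalg_mul f g))) = fun a => \sum_i
    (coord i (phi a f) * deriv i (coord j (phi a g)) +
    - (coord i (phi a g) * deriv i (coord j (phi a f)) *+ c)).
    by apply/funext => a; case: (phiP a) => [[_ ->] _ _]; rewrite coord_mul.
  apply=> i; apply: DAdd; last apply/dpolyN/dpolyMn.
    by apply: DMul; [exact: fP|exact: good_deriv].
  by apply: DMul; [exact: gP|exact: good_deriv].
have all_good f : good f.
  pose S := Subalgebra good0 good_lin good_mul.
  apply: (coproduct_generated (S := S) D_cop) => [e j|x].
    have := DConst u (fun=> True) (coord j e); congr dpoly.
    by apply/funext => a; case: (phiP a) => _ ->.
  have [_ _ iFh _] := D_cop.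
  have SF0 : good (iF 0) by rewrite (nalg_hom0 iFh).
  have SFl r y y' : good (iF y) -> good (iF y') -> good (iF (r *: y + y')).
    by rewrite iFh.1; exact: good_lin.
  have SFm y y' : good (iF y) -> good (iF y') -> good (iF (nalg_mul y y')).
    by rewrite iFh.2; exact: good_mul.
  apply: (free_generated (S := Subalgebra SF0 SFl SFm) F_free) => l j.
  have := @DVar _ _ _ u (fun=> True) (enum_rank (l, j), 0%MM) I; congr dpoly.
  apply/funext => a; rewrite /u derivm0 enum_rankK /=.
  by case: (phiP a) => _ _ ->.
have one0 : (1 : C) <> 0.
  by move=> /(congr1 (fun g : C => val g 0)) /eqP; exact/negP/oner_neq0.
refine (dpoly_closed_noetherian (line_poly_fun_domain mpoly_char0)
  (line_poly_fun_torsion_free mpoly_char0) derivD derivM u_shift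
  (@rank_lt_wf N m) (@rank_lt_trans N m) (@rank_lt_total N m)
  (@rank_lt_shift N m) (@rank_shift_mono N m) (@dickson_derivatives N m)
  one0 _).
move=> _ [S ->] a a0 f Sf; exists (phi a).
have [phih phiA phiz] := phiP a; split=> //.
apply: coord_inj => j; apply: (a0 _ (all_good f j)) => b /(_ f Sf).
move=> [psi [psih psiA psiz psif]].
(* The witness [psi] of [evaluates_to] agrees with [phi b] on the images of [A] and [F], so they
   coincide by uniqueness for the free algebra and the coproduct. *)
suff -> : phi b f = 0 by rewrite coord0.
have [bh bA bz] := phiP b; rewrite -[RHS]psif.
have [_ _ iFh D_univ] := D_cop.
have [h [hh hz h_unique]] := F_free.2 A b MA.
have idh : is_nalg_hom (@id A) by split.
have [w [_ _ _ w_unique]] := D_univ A id h MA idh hh.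
have hE (psi' : D -> A) : is_nalg_hom psi' -> (forall j, psi' (iF (z j)) = b j) ->
    forall y, psi' (iF y) = h y.
  move=> psi'h psi'z; apply: (h_unique (psi' \o iF)) => //.
  exact: nalg_hom_comp iFh psi'h.
by rewrite (w_unique _ bh bA (hE _ bh bz)) (w_unique _ psih psiA (hE _ psih psiz)).
Qed.

End FreeAlgebrasOfVectorFields.

(** * The left-symmetric and Lie cases *)

Theorem corollary7 (R : idomainType) (Q_in_R : {rmorphism rat -> R})
    (R_rad_noeth : radically_noetherian R) (m : nat) (m_ge1 : (1 <= m)%N) :
  (forall (X : Type) (A : nalg R) (i : X -> A),
      is_free (Var (left_symmetric_witt R m)) i -> equationally_noetherian A)
  /\
  (forall (X : Type) (A : nalg R) (i : X -> A),
      is_free (Var (witt_algebra R m)) i -> equationally_noetherian A).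
Proof.
have R_char0 (k : nat) : k.+1%:R <> 0 :> R.
  by rewrite -(rmorph_nat Q_in_R) => /eqP; rewrite fmorph_eq0 Num.Theory.pnatr_eq0.
split=> X A i A_free.
  apply: (free_equationally_noetherian (c := 0) R_char0 _ A_free) => v w j.
  by rewrite ffunE; apply: eq_bigr => l _; rewrite mulr0n subr0.
apply: (free_equationally_noetherian (c := 1) R_char0 _ A_free) => v w j.
by rewrite !ffunE -sumrB; apply: eq_bigr => l _; rewrite mulr1n.
Qed.
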